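(* Let $R$ be a commutative ring, $\mathcal C$ a poset, and $M$ an $R\mathcal C$-module. If $M$ is finitely presented, then 1) $M(c)$ is a finitely presented $R$-module for all $c\in\mathcal C$; 2) $M$ is $S$-determined for some finite $S\subseteq\mathcal C$. Furthermore, if $\mathcal C$ is weakly bounded from above and mub-complete, and $M$ satisfies conditions 1) and 2), then $M$ is finitely presented.
   Context: A poset $\mathcal C$ is regarded as a category with a unique morphism $c\to d$ iff $c\le d$. An $R\mathcal C$-module is a functor $M\colon\mathcal C\to R\text{-}\mathbf{Mod}$; morphisms are natural transformations, and exactness is pointwise. $R[\mathrm{Mor}_{\mathcal C}(c,-)]$ is the $R\mathcal C$-module sending $d$ to the free $R$-module on the set $\mathrm{Mor}_{\mathcal C}(c,d)$. $M$ is finitely presented if there is an exact sequence $\bigoplus_{j\in J}R[\mathrm{Mor}_{\mathcal C}(d_j,-)]\to\bigoplus_{i\in I}R[\mathrm{Mor}_{\mathcal C}(c_i,-)]\to M\to 0$ with $I,J$ finite sets and $c_i,d_j\in\mathcal C$. For $T\subseteq\mathcal C$: ${\uparrow}T=\{c\mid t\le c\text{ for some }t\in T\}$; for $c\in\mathcal C$, ${\downarrow}c=\{d\in\mathcal C\mid d\le c\}$. $\mathrm{Supp}(M)=\{c\in\mathcal C\mid M(c)\ne0\}$. For $S\subseteq\mathcal C$, $M$ is $S$-determined if $\mathrm{Supp}(M)\subseteq{\uparrow}S$ and for every $c\le d$ in $\mathcal C$, $S\cap{\downarrow}c=S\cap{\downarrow}d$ implies that $M(c\le d)$ is an isomorphism.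 $\mathcal C$ is weakly bounded from above if every finite subset of $\mathcal C$ has a finite number of minimal upper bounds in $\mathcal C$. $\mathcal C$ is mub-complete if for every finite non-empty $S\subseteq\mathcal C$ and every upper bound $c$ of $S$ there is a minimal upper bound $s$ of $S$ with $s\le c$. *)

(* Defs.v *)
From HB Require Import structures.
From mathcomp Require Import all_boot all_order all_algebra.
From mathcomp Require Import boolp classical_sets cardinality.

Set Implicit Arguments.
Unset Strict Implicit.
Unset Printing Implicit Defensive.

Import Order.TTheory GRing.Theory.
Local Open Scope ring_scope.
Local Open Scope classical_set_scope.

Section Modules.
Variable R : comPzRingType.

(* [R^o] is [R] as a module over itself. *)
Definition free_mod (X : finType) : lmodType R := {ffun X -> R^o}.

(* The basis vector x is sent to the basis vector f x. *)
Definition free_map (X Y : finType) (f : X -> Y) (v : free_mod X) : free_mod Y :=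
  [ffun y => \sum_(x | f x == y) v x].

Lemma free_map_is_linear (X Y : finType) (f : X -> Y) : linear (free_map f).
Proof.
move=> a u v; apply/ffunP => y; rewrite !ffunE scaler_sumr -big_split /=.
by apply: eq_bigr => x _; rewrite !ffunE.
Qed.

HB.instance Definition _ (X Y : finType) (f : X -> Y) :=
  GRing.isLinear.Build R (free_mod X) (free_mod Y) *:%R (free_map f)
    (free_map_is_linear f).

Lemma free_map_id (X : finType) (f : X -> X) (v : free_mod X) :
  f =1 id -> free_map f v = v.
Proof.
by move=> fE; apply/ffunP => y; rewrite ffunE (big_pred1 y) // => x; rewrite fE.
Qed.

Lemma free_map_comp (X Y Z : finType) (f : X -> Y) (g : Y -> Z) (h : X -> Z)
    (v : free_mod X) :
  h =1 g \o f -> free_map h v = free_map g (free_map f v).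
Proof.
move=> hE; apply/ffunP => z; rewrite !ffunE.
rewrite (partition_big f (fun y => g y == z)) /=; last by move=> x; rewrite hE.
apply: eq_bigr => y /eqP gyz; rewrite ffunE; apply: eq_bigl => x.
by rewrite hE /=; case: (f x =P y) => [->|]; rewrite ?andbF // gyz eqxx.
Qed.

Section DirectSum.
Variables (I : finType) (V : I -> lmodType R).

Definition dsum_type := {dffun forall i, V i}.
HB.instance Definition _ := Choice.on dsum_type.

Implicit Types u v : dsum_type.

Definition dsum_zero : dsum_type := finfun (fun i => 0 : V i).
Definition dsum_opp u : dsum_type := finfun (fun i => - u i).
Definition dsum_add u v : dsum_type := finfun (fun i => u i + v i).
Definition dsum_scale (a : R) u : dsum_type := finfun (fun i => a *: u i).

Fact dsum_addA : associative dsum_add.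
Proof. by move=> u v w; apply/ffunP => i; rewrite !ffunE addrA. Qed.
Fact dsum_addC : commutative dsum_add.
Proof. by move=> u v; apply/ffunP => i; rewrite !ffunE addrC. Qed.
Fact dsum_add0 : left_id dsum_zero dsum_add.
Proof. by move=> u; apply/ffunP => i; rewrite !ffunE add0r. Qed.
Fact dsum_addN : left_inverse dsum_zero dsum_opp dsum_add.
Proof. by move=> u; apply/ffunP => i; rewrite !ffunE addNr. Qed.

HB.instance Definition _ :=
  GRing.isZmodule.Build dsum_type dsum_addA dsum_addC dsum_add0 dsum_addN.

Fact dsum_scaleA a b u :
  dsum_scale a (dsum_scale b u) = dsum_scale (a * b) u.
Proof. by apply/ffunP => i; rewrite !ffunE scalerA. Qed.
Fact dsum_scale1 : left_id 1 dsum_scale.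
Proof. by move=> u; apply/ffunP => i; rewrite !ffunE scale1r. Qed.
Fact dsum_scaleDr : right_distributive dsum_scale +%R.
Proof. by move=> a u v; apply/ffunP => i; rewrite !ffunE scalerDr. Qed.
Fact dsum_scaleDl u : {morph dsum_scale^~ u : a b / a + b}.
Proof. by move=> a b; apply/ffunP => i; rewrite !ffunE scalerDl. Qed.

HB.instance Definition _ :=
  GRing.Zmodule_isLmodule.Build R dsum_type
    dsum_scaleA dsum_scale1 dsum_scaleDr dsum_scaleDl.

Definition dsum : lmodType R := dsum_type.

End DirectSum.

Definition dsum_map (I : finType) (V W : I -> lmodType R)
    (f : forall i, {linear V i -> W i}) (u : dsum V) : dsum W :=
  finfun (fun i => f i (u i)).

Lemma dsum_map_is_linear (I : finType) (V W : I -> lmodType R)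
  (f : forall i, {linear V i -> W i}) : linear (dsum_map f).
Proof. by move=> a u v; apply/ffunP => i; rewrite !ffunE linearP. Qed.

HB.instance Definition _ (I : finType) (V W : I -> lmodType R)
    (f : forall i, {linear V i -> W i}) :=
  GRing.isLinear.Build R (dsum V) (dsum W) *:%R (dsum_map f)
    (dsum_map_is_linear f).

Definition is_exact (U V W : lmodType R)
    (f : {linear U -> V}) (g : {linear V -> W}) : Prop :=
  forall v : V, g v = 0 <-> exists u : U, f u = v.

(* Exactness of U -> V -> W -> 0. *)
Definition right_exact (U V W : lmodType R)
    (f : {linear U -> V}) (g : {linear V -> W}) : Prop :=
  is_exact f g /\ forall w : W, exists v : V, g v = w.

Definition fp_module (V : lmodType R) : Prop :=
  exists (I J : finType) (f : {linear free_mod J -> free_mod I})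
         (g : {linear free_mod I -> V}), right_exact f g.

Definition is_iso (V W : lmodType R) (f : {linear V -> W}) : Prop :=
  exists g : {linear W -> V}, cancel f g /\ cancel g f.

End Modules.

Section PosetModules.
Variables (R : comPzRingType) (disp : Order.disp_t) (C : porderType disp).
Local Open Scope order_scope.

(* The proof argument of [act] is irrelevant, [c <= d] being boolean. *)
Record rcmod := RCMod {
  obj :> C -> lmodType R;
  act : forall c d : C, c <= d -> {linear obj c -> obj d};
  act_id : forall (c : C) (x : obj c), act (lexx c) x = x;
  act_comp : forall (c d e : C) (cd : c <= d) (de : d <= e) (x : obj c),
    act (le_trans cd de) x = act de (act cd x)
}.

Record rcmor (M N : rcmod) := RCMor {
  component :> forall c : C, {linear M c -> N c};
  naturality : forall (c d : C) (cd : c <= d) (x : M c),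
    component d (act M cd x) = act N cd (component c x)
}.

(* A singleton if c <= d, and empty otherwise. *)
Definition Mor (c d : C) : finType := {_ : unit | c <= d}.

Definition postcomp (c d e : C) (de : d <= e) (f : Mor c d) : Mor c e :=
  exist _ tt (le_trans (valP f) de).

Lemma Mor_unique (c d : C) (f g : Mor c d) : f = g.
Proof. by apply/val_inj; case: (val f); case: (val g). Qed.

Definition rep_obj (c d : C) : lmodType R := free_mod R (Mor c d).

Definition rep_act (c d e : C) (de : d <= e) :
    {linear rep_obj c d -> rep_obj c e} :=
  free_map (postcomp de).

Lemma rep_act_id (c d : C) (x : rep_obj c d) : rep_act c (lexx d) x = x.
Proof. by apply: free_map_id => f; apply: Mor_unique. Qed.

Lemma rep_act_comp (c d e e' : C) (de : d <= e) (ee' : e <= e')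
    (x : rep_obj c d) :
  rep_act c (le_trans de ee') x = rep_act c ee' (rep_act c de x).
Proof. by apply: free_map_comp => f; apply: Mor_unique. Qed.

(* R[Mor(c, -)] *)
Definition rep (c : C) : rcmod := RCMod (@rep_act_id c) (@rep_act_comp c).

Section RCDirectSum.
Variables (I : finType) (N : I -> rcmod).

Definition rcsum_obj (c : C) : lmodType R := dsum (fun i => N i c).

Definition rcsum_act (c d : C) (cd : c <= d) :
    {linear rcsum_obj c -> rcsum_obj d} :=
  dsum_map (fun i => act (N i) cd).

Lemma rcsum_act_id (c : C) (x : rcsum_obj c) : rcsum_act (lexx c) x = x.
Proof. by apply/ffunP => i; rewrite ffunE act_id. Qed.

Lemma rcsum_act_comp (c d e : C) (cd : c <= d) (de : d <= e)
    (x : rcsum_obj c) :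
  rcsum_act (le_trans cd de) x = rcsum_act de (rcsum_act cd x).
Proof. by apply/ffunP => i; rewrite !ffunE act_comp. Qed.

Definition rcsum : rcmod := RCMod rcsum_act_id rcsum_act_comp.

End RCDirectSum.

Definition finitely_presented (M : rcmod) : Prop :=
  exists (I J : finType) (c : I -> C) (d : J -> C)
         (f : rcmor (rcsum (fun j => rep (d j))) (rcsum (fun i => rep (c i))))
         (g : rcmor (rcsum (fun i => rep (c i))) M),
    forall x : C, right_exact (f x) (g x).

Definition upset (T : set C) : set C := [set c | exists2 t, T t & t <= c].

Definition downset (c : C) : set C := [set d | d <= c].

Definition Supp (M : rcmod) : set C := [set c | exists x : M c, x <> 0%R].

Definition determined (S : set C) (M : rcmod) : Prop :=
  Supp M `<=` upset S /\
  forall (c d : C) (cd : c <= d),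
    S `&` downset c = S `&` downset d -> is_iso (act M cd).

Definition mub (S : set C) : set C :=
  [set s | ubound S s /\ forall t, ubound S t -> t <= s -> t = s].

(* The empty subset is included here: its minimal upper bounds are the minimal
   elements of C. *)
Definition weakly_bounded_above : Prop :=
  forall S : set C, finite_set S -> finite_set (mub S).

Definition mub_complete : Prop :=
  forall S : set C, finite_set S -> S !=set0 ->
  forall c, ubound S c -> exists2 s, mub S s & s <= c.

End PosetModules.

(* Main.v *)
Require Import Defs.
From HB Require Import structures.
From mathcomp Require Import all_boot all_order all_algebra.
From mathcomp Require Import boolp classical_sets cardinality.

Set Implicit Arguments.
Unset Strict Implicit.
Unset Printing Implicit Defensive.

Import Order.TTheory GRing.Theory.
Local Open Scope ring_scope.
Local Open Scope classical_set_scope.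

(** Given a presentation with generators placed at the [c i] and relations placed
    at the [d j], evaluating it at a point gives a finite presentation, and the
    free terms, hence also M, only see which [c i] and [d j] lie below.

    Conversely, let S be finite and let T consist of the minimal upper bounds of
    the subsets of S. Below each x in the up-closure of S there is a t in T with
    the same elements of S below it: a minimal upper bound of the elements of S
    below x. So an S-determined M is generated by its values on the finite set T,
    which gives a surjection F -> M with F finite free. Its kernel satisfies the
    same conditions for the union of S with the positions of the generators of F,
    its values being finitely generated because those of M are finitely
    presented; so the kernel is finitely generated too. *)

(** * Finite generation and finite presentation over [R] *)

Section Modules.
Variable R : comPzRingType.

Definition free_lift (X : finType) (V : lmodType R) (g : X -> V)
    (a : free_mod R X) : V := \sum_x (a x : R) *: g x.

Lemma free_lift_is_linear (X : finType) (V : lmodType R) (g : X -> V) :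
  linear (free_lift g).
Proof.
move=> a u v; rewrite /free_lift scaler_sumr -big_split /=.
by apply: eq_bigr => x _; rewrite !ffunE scalerDl scalerA.
Qed.

HB.instance Definition _ (X : finType) (V : lmodType R) (g : X -> V) :=
  GRing.isLinear.Build R (free_mod R X) V *:%R (free_lift g)
    (free_lift_is_linear g).

Lemma eq_free_lift (X : finType) (V : lmodType R) (g h : X -> V) :
  g =1 h -> free_lift g =1 free_lift h.
Proof. by move=> gh a; apply: eq_bigr => x _; rewrite gh. Qed.

Lemma linear_free_lift (X : finType) (V W : lmodType R) (h : {linear V -> W})
    (g : X -> V) a :
  h (free_lift g a) = free_lift (h \o g) a.
Proof. by rewrite linear_sum; apply: eq_bigr => x _; rewrite linearZ. Qed.

Lemma free_lift_map (X Y : finType) (V : lmodType R) (f : X -> Y)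
    (g : Y -> V) (a : free_mod R X) :
  free_lift g (free_map f a) = free_lift (g \o f) a.
Proof.
rewrite /free_lift [RHS](partition_big f predT) //=.
apply: eq_bigr => y _; rewrite ffunE scaler_suml.
by apply: eq_bigr => x /eqP <-.
Qed.

Definition free_basis (X : finType) (x : X) : free_mod R X :=
  [ffun y => (y == x)%:R].

Lemma free_lift_basis (X : finType) (a : free_mod R X) :
  free_lift (@free_basis X) a = a.
Proof.
apply/ffunP => y; rewrite /free_lift sum_ffunE (bigD1 y) //= big1 => [|x nxy].
  by rewrite !ffunE eqxx /= addr0 [_ *: _]mulr1.
by rewrite !ffunE eq_sym (negPf nxy) scaler0.
Qed.

Lemma bij_is_iso (V W : lmodType R) (f : {linear V -> W}) :
  (forall v, f v = 0 -> v = 0) -> (forall w, exists v, f v = w) -> is_iso f.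
Proof.
move=> inj0 surj; have [g gK] := choice surj.
have Kg : cancel f g.
  by move=> v; apply/subr0_eq/inj0; rewrite linearB /= gK subrr.
pose gL := GRing.isLinear.Build R W V *:%R g (can2_linear Kg gK).
pose g' : {linear W -> V} := HB.pack g gL.
by exists g'.
Qed.

(** [P] stands for a submodule; as a predicate, it spares turning kernels into modules of their
    own. *)
Definition finitely_generated_by (V : lmodType R) (P : V -> Prop) : Prop :=
  exists (X : finType) (g : X -> V), (forall x, P (g x)) /\
    forall v, P v -> exists a, free_lift g a = v.

Lemma fp_module_fg (V : lmodType R) :
  fp_module V -> finitely_generated_by (fun _ : V => True).
Proof.
move=> [I [J [f [g [_ surj]]]]]; exists I, (g \o @free_basis I); split=> // v _.
have [a <-] := surj v; exists a.
by rewrite -linear_free_lift free_lift_basis.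
Qed.

(* The kernel of [h] is generated by the lifts to W of the relations of V, and by
   the differences between the generators of W and lifts of their images. *)
Lemma fp_module_ker_fg (V W : lmodType R) (h : {linear W -> V}) :
  fp_module V -> finitely_generated_by (fun _ : W => True) ->
  (forall v, exists w, h w = v) ->
  finitely_generated_by (fun w => h w = 0).
Proof.
move=> [I [J [f [g [ex gsurj]]]]] [X [e [_ egen]]] hsurj.
have [w wE] := choice (fun i => hsurj (g (free_basis i))).
have [v vE] := choice (fun x => gsurj (h (e x))).
have hw a : h (free_lift w a) = g a.
  rewrite linear_free_lift (eq_free_lift (h := g \o @free_basis I)) //.
  by rewrite -linear_free_lift free_lift_basis.
have gf a : g (f a) = 0 by apply/ex; exists a.
pose k (s : J + X) : W :=
  match s with
  | inl j => free_lift w (f (free_basis j))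
  | inr x => e x - free_lift w (v x)
  end.
exists (J + X)%type, k; split=> [[j|x]|y hy] /=.
- by rewrite hw gf.
- by rewrite linearB /= hw vE subrr.
have [a aE] := egen y Logic.I.
(* Writing [y] in the generators [e] with coefficients [a], [h y = 0] says that the lifted
   combination in [free_mod I] is a relation, so it comes from some [b]. *)
have /ex [b bE] : g (free_lift v a) = 0.
  by rewrite linear_free_lift (eq_free_lift (h := h \o e)) //
             -linear_free_lift aE.
exists [ffun s => match s with inl j => b j | inr x => a x end].
rewrite /free_lift big_sumType /=.
under eq_bigr do rewrite ffunE.
under [X in _ + X]eq_bigr do rewrite ffunE scalerBr.
rewrite sumrB addrCA -[in RHS]aE -[RHS]addr0; congr (_ + _).
apply/eqP; rewrite subr_eq0; apply/eqP.
rewrite -[LHS]/(free_lift (free_lift w \o (f \o @free_basis J)) b).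
rewrite -[RHS]/(free_lift (free_lift w \o v) a).
by rewrite -!linear_free_lift free_lift_basis bE.
Qed.

Section SumOfFree.
Variables (I : finType) (X : I -> finType).

Let V (i : I) := free_mod R (X i).

Definition sum_of_free (u : free_mod R {i : I & X i}) : dsum V :=
  finfun (fun i => [ffun x => u (Tagged X x)] : V i).

Lemma sum_of_free_is_linear : linear sum_of_free.
Proof.
by move=> a u v; apply/ffunP => i; rewrite !ffunE; apply/ffunP => x;
rewrite !ffunE.
Qed.

HB.instance Definition _ :=
  GRing.isLinear.Build R (free_mod R {i : I & X i}) (dsum V) *:%R sum_of_free
    sum_of_free_is_linear.

Lemma sum_of_free_iso : is_iso sum_of_free.
Proof.
apply: bij_is_iso => [u u0|v].
  apply/ffunP => -[i x].
  by move/ffunP/(_ i)/ffunP/(_ x): u0; rewrite !ffunE.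
exists [ffun p : {i : I & X i} => v (tag p) (tagged p)].
by apply/ffunP => i; rewrite ffunE; apply/ffunP => x; rewrite !ffunE.
Qed.

Lemma dsum_free_fg : finitely_generated_by (fun _ : dsum V => True).
Proof.
have [g [_ gK]] := sum_of_free_iso.
exists {i : I & X i}, (sum_of_free \o @free_basis _); split=> // v _.
by exists (g v); rewrite -linear_free_lift free_lift_basis gK.
Qed.

End SumOfFree.

(** A sum of free modules is free on the disjoint union of the bases; conjugating by these
    isomorphisms preserves exactness. *)
Lemma right_exact_fp (I J : finType) (X : I -> finType) (Y : J -> finType)
    (W : lmodType R)
    (f : {linear dsum (fun j => free_mod R (Y j)) ->
                 dsum (fun i => free_mod R (X i))})
    (g : {linear dsum (fun i => free_mod R (X i)) -> W}) :
  right_exact f g -> fp_module W.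
Proof.
move=> [ex surj].
have [p [sK pK]] := sum_of_free_iso X; have [q [_ qK]] := sum_of_free_iso Y.
pose f' : {linear _ -> _} := p \o f \o @sum_of_free _ Y.
pose g' : {linear _ -> _} := g \o @sum_of_free _ X.
exists {i : I & X i}, {j : J & Y j}, f', g'; split=> [v|w].
  split=> [/ex[u uE]|[u <-]]; last by rewrite /= pK; apply/ex; exists (sum_of_free u).
  by exists (q u); rewrite /= qK uE sK.
by have [v <-] := surj w; exists (p v); rewrite /= pK.
Qed.

End Modules.

(** * Modules over the poset [C] *)

Section PosetModules.
Variables (R : comPzRingType) (disp : Order.disp_t) (C : porderType disp).
Implicit Types (M N : rcmod R C).

Section Yoneda.
Variables (N : rcmod R C) (I : finType) (c : I -> C) (m : forall i, N (c i)).

(** The morphism that the Yoneda lemma attaches to the elements [m i]. *)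
Definition yoneda_fun (x : C) (u : rcsum (fun i => rep R (c i)) x) : N x :=
  \sum_i free_lift (fun f : Mor (c i) x => act N (valP f) (m i)) (u i).

Lemma yoneda_fun_is_linear x : linear (@yoneda_fun x).
Proof.
move=> a u v; rewrite /yoneda_fun scaler_sumr -big_split /=.
by apply: eq_bigr => i _; rewrite !ffunE linearP.
Qed.

HB.instance Definition _ x :=
  GRing.isLinear.Build R (rcsum (fun i => rep R (c i)) x) (N x) *:%R
    (@yoneda_fun x) (@yoneda_fun_is_linear x).

Lemma yoneda_natural (x y : C) (xy : (x <= y)%O) u :
  yoneda_fun (act (rcsum (fun i => rep R (c i))) xy u) =
  act N xy (yoneda_fun u).
Proof.
rewrite /yoneda_fun linear_sum; apply: eq_bigr => i _.
rewrite linear_free_lift ffunE [LHS]free_lift_map; apply: eq_free_lift => f /=.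
by rewrite -act_comp; congr (act N _ _); apply: bool_irrelevance.
Qed.

Definition yoneda : rcmor (rcsum (fun i => rep R (c i))) N :=
  RCMor (component := fun x => @yoneda_fun x : {linear _ -> _}) yoneda_natural.

Lemma yoneda_gen (i : I) : exists u, yoneda (c i) u = m i.
Proof.
(* This is the identity of [c i] in the summand [i]: [Mor (c i) (c i)] is a singleton, so the
   constant 1 is its basis vector. *)
exists (finfun (fun j => if j == i then [ffun=> 1] else 0 : rep_obj R (c j) (c i))).
rewrite /= /yoneda_fun (bigD1 i) //= big1 => [|j nji]; last first.
  by rewrite ffunE (negPf nji) linear0.
rewrite ffunE eqxx addr0 /free_lift.
rewrite (big_pred1 (exist _ tt (lexx (c i)) : Mor (c i) (c i))) => [|f].
  rewrite ffunE scale1r -[RHS]act_id /=.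
  by congr (act N _ _); apply: bool_irrelevance.
by rewrite [f](Mor_unique _ (exist _ tt (lexx (c i)))) /= eqxx.
Qed.

Lemma linear_yoneda_eq0 (W : rcmod R C) (g : rcmor N W) (x : C) u :
  (forall i, g (c i) (m i) = 0) -> g x (yoneda x u) = 0.
Proof.
move=> gm; rewrite /= /yoneda_fun linear_sum big1 // => i _.
rewrite linear_free_lift /free_lift big1 // => f _ /=.
by rewrite naturality gm linear0 scaler0.
Qed.

End Yoneda.

Section SumOfRepresentables.
Variables (I : finType) (c : I -> C) (x y : C) (xy : (x <= y)%O).
Hypothesis cxy : forall i, (c i <= y)%O -> (c i <= x)%O.

Let precomp (i : I) (f : Mor (c i) y) : Mor (c i) x :=
  exist _ tt (cxy (valP f)).

(** For each [i], the sets [Mor (c i) x] and [Mor (c i) y] are both empty or both singletons. *)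
Lemma rcsum_act_bij : bijective (act (rcsum (fun i => rep R (c i))) xy).
Proof.
exists (dsum_map (fun i => free_map (@precomp i) : {linear _ -> _})) => u;
  apply/ffunP => i; rewrite !ffunE -[LHS](@free_map_comp R _ _ _ _ _ id) ?free_map_id //;
  move=> f; exact: Mor_unique.
Qed.

End SumOfRepresentables.

Lemma setI_downset_le (S : set C) (c d s : C) :
  S `&` downset c = S `&` downset d -> S s -> (s <= d)%O -> (s <= c)%O.
Proof. by move=> /seteqP[_ sub] Ss sd; have [] := sub s (conj Ss sd). Qed.

Lemma presentation_determined M (I J : finType) (c : I -> C) (d : J -> C)
    (f : rcmor (rcsum (fun j => rep R (d j))) (rcsum (fun i => rep R (c i))))
    (g : rcmor (rcsum (fun i => rep R (c i))) M) :
  (forall x, right_exact (f x) (g x)) ->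
  determined (range c `|` range d) M.
Proof.
move=> ex; split=> [x [v v0]|x y xy dxy].
  have [_ /(_ v) [u uE]] := ex x; apply: contrapT => nx; apply: v0.
  rewrite -uE (_ : u = 0) ?linear0 //.
  apply/ffunP => i; rewrite ffunE; apply/ffunP => h; case: nx.
  by exists (c i); [left; exists i | exact: valP h].
have le_x := setI_downset_le dxy.
have [p pK Kp] : bijective (act (rcsum (fun i => rep R (c i))) xy).
  by apply: rcsum_act_bij => i; apply: le_x; left; exists i.
have [q _ Kq] : bijective (act (rcsum (fun j => rep R (d j))) xy).
  by apply: rcsum_act_bij => j; apply: le_x; right; exists j.
have [exx gx] := ex x; have [exy gy] := ex y.
apply: bij_is_iso => [v|w].
  (* Injectivity: a lift [u] of [v] becomes a relation [t] at [y], and [q] carries [t] back to a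
     relation at [x]. *)
  have [u <-] := gx v; rewrite -naturality => /exy [t tE].
  apply/exx; exists (q t); apply: (can_inj pK).
  by rewrite -naturality Kq.
have [u <-] := gy w; exists (g x (p u)).
by rewrite -naturality Kp.
Qed.

Lemma finite_subsets (T : choiceType) (A : set T) :
  finite_set A -> finite_set [set B | B `<=` A].
Proof.
move=> /finite_seqP [s ->].
apply: (@sub_finite_set _ _
  ((fun B : {set seq_sub s} => [set ssval x | x in [set` B]]) @` setT)).
  move=> B sB; exists [set x : seq_sub s | `[< B (ssval x) >]]%SET => //=.
  apply/seteqP; split=> [_ [x /= + <-]|x Bx]; first by rewrite inE => /asboolP.
  by exists (SeqSub (sB x Bx)) => //=; rewrite inE; apply/asboolP.
exact: finite_image.
Qed.

Lemma finite_representatives (T : set C) :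
  weakly_bounded_above C -> mub_complete C -> finite_set T ->
  exists s : seq C, forall x, upset T x ->
    exists t, [/\ t \in s, (t <= x)%O & T `&` downset t = T `&` downset x].
Proof.
move=> wb mc finT.
have /finite_seqP [s sE] : finite_set (\bigcup_(A in [set B | B `<=` T]) mub A).
  apply: bigcup_finite => [|A AT]; first exact: finite_subsets.
  exact/wb/(sub_finite_set AT).
exists s => x [t Tt tx].
have [|||m mmub mx] := mc (T `&` downset x) _ _ x.
- exact: finite_setIl.
- by exists t.
- by move=> y [].
exists m; split=> //.
  suff : [set` s] m by [].
  by rewrite -sE; exists (T `&` downset x) => // y [].
(* One inclusion uses [m <= x], the other that [m] bounds the elements of [T] below [x]. *)
apply/seteqP; split=> y [Ty yx]; split=> //=; first exact: le_trans yx mx.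
by case: mmub => + _; apply; split.
Qed.

(* [P] plays the role of a submodule of [N]. *)
Lemma generators_exist N (P : forall x, N x -> Prop) (T : set C) :
  weakly_bounded_above C -> mub_complete C -> finite_set T ->
  (forall x y, ~ upset T x -> P x y -> y = 0) ->
  (forall x x' (xx' : (x <= x')%O), T `&` downset x = T `&` downset x' ->
    forall y, P x' y -> exists2 z, P x z & act N xx' z = y) ->
  (forall x, finitely_generated_by (P x)) ->
  exists (I : finType) (c : I -> C) (m : forall i, N (c i)),
    (forall i, P (c i) (m i)) /\
    forall x y, P x y -> exists u, yoneda m x u = y.
Proof.
move=> wb mc finT supp det fgP.
have [s sP] := finite_representatives wb mc finT.
pose X x := projT1 (cid (fgP x)).
have gen x : exists g : X x -> N x, (forall k, P x (g k)) /\
    forall v, P x v -> exists a, free_lift g a = v.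
  exact: projT2 (cid (fgP x)).
pose g x := projT1 (cid (gen x)).
have gP x k : P x (g x k).
  by have [gP _] := projT2 (cid (gen x)); apply: gP.
have ggen x v : P x v -> exists a, free_lift (g x) a = v.
  by have [_ gG] := projT2 (cid (gen x)); apply: gG.
(* All the chosen generators of [P t], for [t] in the finite list [s]. *)
pose I : finType := {t : seq_sub s & X (ssval t)}.
pose c (i : I) := ssval (tag i).
pose m (i : I) : N (c i) := g (c i) (tagged i).
exists I, c, m; split=> [i|x y Pxy]; first exact: gP.
have [/sP [t [ts tx dtx]]|nx] := EM (upset T x); last first.
  by exists 0; rewrite linear0 (supp x y).
have [z Pz <-] := det t x tx dtx y Pxy.
have [a <-] := ggen t z Pz.
have gt k : exists u, yoneda m t u = g t k.
  exact: yoneda_gen m (Tagged (fun t => X (ssval t)) (k : X (ssval (SeqSub ts)))).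
have [u uE] := choice gt.
exists (act (rcsum (fun i => rep R (c i))) tx (free_lift u a)).
rewrite naturality linear_free_lift; congr (act N tx _).
by apply: eq_free_lift => k; apply: uE.
Qed.

Lemma determined_finitely_presented M (S : set C) :
  weakly_bounded_above C -> mub_complete C ->
  (forall x, fp_module (M x)) -> finite_set S -> determined S M ->
  finitely_presented M.
Proof.
move=> wb mc fpM finS [suppM detM].
have [||x|I [c [m [_ gsurj]]]] :=
    @generators_exist M (fun _ _ => True) S wb mc finS.
- move=> x y nx _; apply: contrapT => y0; apply: nx; apply: suppM.
  by exists y.
- move=> x x' xx' dxx' y _; have [h [_ hK]] := detM x x' xx' dxx'.
  by exists (h y).
- exact/fp_module_fg/fpM.
have {}gsurj x y : exists u, yoneda m x u = y by exact: gsurj.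
pose F := rcsum (fun i => rep R (c i)).
(* Adding [range c] to [S] makes the action on [F] bijective, too, wherever the set below is
   unchanged. *)
have [|||x|J [d [k [kP kgen]]]] :=
    @generators_exist F (fun x u => yoneda m x u = 0) (S `|` range c) wb mc.
- by rewrite finite_setU; split=> //; apply: finite_image.
- move=> x u nx _; apply/ffunP => i; rewrite ffunE; apply/ffunP => h; case: nx.
  by exists (c i); [right; exists i | exact: valP h].
- move=> x x' xx' dxx' u u0.
  have le_x := setI_downset_le dxx'.
  have [p pK Kp] : bijective (act F xx').
    by apply: rcsum_act_bij => i; apply: le_x; right; exists i.
  have [|h [hK _]] := detM x x' xx'.
    apply/seteqP; split=> y [Sy yx]; split=> //=; first exact: le_trans yx xx'.
    by apply: le_x yx; left.
  (* The preimage of [u] lies in the kernel at [x] because the action of [M] from [x] to [x'] is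
     injective. *)
  exists (p u) => //; apply: (can_inj hK).
  by rewrite -naturality Kp u0 linear0.
- by apply: fp_module_ker_fg => //; apply: dsum_free_fg.
exists I, J, c, d, (yoneda k), (yoneda m) => x; split=> [v|]; last exact: gsurj.
split=> [/kgen //|[u <-]].
exact: linear_yoneda_eq0.
Qed.

End PosetModules.

Theorem theorem4p15 (R : comPzRingType) (disp : Order.disp_t)
    (C : porderType disp) (M : rcmod R C) :
  (finitely_presented M ->
     (forall c : C, fp_module (M c)) /\
     (exists S : set C, finite_set S /\ determined S M)) /\
  (weakly_bounded_above C -> mub_complete C ->
     (forall c : C, fp_module (M c)) ->
     (exists S : set C, finite_set S /\ determined S M) ->
     finitely_presented M).
Proof.
split=> [[I [J [c [d [f [g ex]]]]]]|wb mc fpM [S [finS detS]]].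
  split=> [x|]; first exact: right_exact_fp (ex x).
  exists (range c `|` range d); split; last exact: presentation_determined ex.
  by rewrite finite_setU; split; apply: finite_image.
exact: determined_finitely_presented detS.
Qed.
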